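(* A torsion-free divisible Abelian group is perspective if and only if it has finite rank. As such, it is isomorphic to a finite direct sum of copies of $\mathbb{Q}$.
   Context: An Abelian group $G$ is called perspective if any two isomorphic direct summands of $G$ have a common direct complement: whenever $G=A\oplus H=B\oplus K$ with $A\cong B$, there exists a subgroup $C\le G$ with $G=A\oplus C=B\oplus C$. *)

(* Defs.v *)
From mathcomp Require Import all_boot all_order all_algebra.
From mathcomp Require Import all_classical.
Set Implicit Arguments.
Unset Strict Implicit.
Unset Printing Implicit Defensive.
Import GRing.Theory.
Local Open Scope ring_scope.
Local Open Scope classical_set_scope.

Section AbelianGroups.
Variable G : zmodType.

Definition torsion_free : Prop :=
  forall (n : nat) (x : G), (0 < n)%N -> x *+ n = 0 -> x = 0.

Definition divisible : Prop :=
  forall (n : nat) (x : G), (0 < n)%N -> exists y : G, y *+ n = x.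

Definition subgroup (A : set G) : Prop := zmod_closed [in A].

Definition is_direct_sum (A B : set G) : Prop :=
  [/\ subgroup A, subgroup B,
      [set a + b | a in A & b in B] = [set: G] & A `&` B = [set 0]].

(* Only the restriction of f to A matters. *)
Definition isomorphic_subgroups (A B : set G) : Prop :=
  exists f : G -> G, set_bij A B f /\ {in A &, {morph f : x y / x + y}}.

Definition perspective : Prop :=
  forall A H B K : set G,
    is_direct_sum A H -> is_direct_sum B K -> isomorphic_subgroups A B ->
    exists C : set G, is_direct_sum A C /\ is_direct_sum B C.

(* Linear independence over the integers of a possibly infinite subset. *)
Definition independent (X : set G) : Prop :=
  forall (s : seq G) (c : G -> int), uniq s -> {subset s <= X} ->
    \sum_(x <- s) x *~ c x = 0 -> {in s, forall x, c x = 0}.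

Definition maximal_independent (X : set G) : Prop :=
  independent X /\
  forall Y : set G, independent Y -> X `<=` Y -> Y `<=` X.

(* The (torsion-free) rank: the cardinality of a maximal independent subset. *)
Definition has_rank (n : nat) : Prop :=
  exists X : set G, maximal_independent X /\ (X #= `I_n)%card.

Definition finite_rank : Prop := exists n : nat, has_rank n.

End AbelianGroups.

Arguments torsion_free : clear implicits.
Arguments divisible : clear implicits.
Arguments perspective : clear implicits.
Arguments has_rank : clear implicits.
Arguments finite_rank : clear implicits.

Definition isomorphic_groups (G H : zmodType) : Prop :=
  exists f : {additive G -> H}, bijective f.

(* Main.v *)
Require Import Defs.
From HB Require Import structures.
From mathcomp Require Import all_boot all_order all_algebra.
From mathcomp Require Import all_classical.

(** A torsion-free divisible group is a rational vector space, and a maximal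
    independent subset is a basis of it. Instead of a module structure over
    the rationals, [G] is given a basis in integral terms: a set that is
    independent over the integers and whose integer span contains a positive
    multiple of every element. Maximal independent sets have this property
    ([maximal_independent_spanning]), and any function from a basis to a
    torsion-free divisible group extends to an additive map
    ([basis_extension]), uniquely ([additive_eq_on_spanning]).

    If the rank is a finite [n], the coordinates in a basis give an
    isomorphism between [G] and the [n]-th power of the rationals ([enumerated_basis_isomorphic]). An additive map between rational
    vector spaces is linear, so by finite dimension [G] is co-Hopfian: its
    injective endomorphisms are surjective.

    A co-Hopfian [G] is perspective ([coHopfian_perspective]). Given isomorphic
    summands [A] and [B], take a subgroup [C] maximal among those that meet both
    trivially. Such a [C] is pure, and by maximality every [g] outside [C] has a
    nonzero multiple congruent modulo [C] to an element of [A] or of [B]; these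
    being divisible, [G] is the union of [A + C] and [B + C]. A group is not the
    union of two proper subgroups, so one of them, say [A + C], is [G]. The
    endomorphism that maps [A] isomorphically to [B] and fixes [C] is then
    injective, hence surjective, which says [B + C = G].

    Conversely, let [G] be perspective. If [g \o f] is the identity of [G],
    then [G] itself and its isomorphic summand [range f] share a complement;
    a complement of [G] is trivial, so [f] is surjective and [g] is injective
    ([perspective_left_inverse_injective]). An infinite basis would contradict
    this: take for [f] the shift along a sequence of distinct basis elements and
    for [g] the backward shift, which kills the first of them. *)

Set Implicit Arguments.
Unset Strict Implicit.
Unset Printing Implicit Defensive.
Import GRing.Theory Num.Theory.
Local Open Scope ring_scope.
Local Open Scope classical_set_scope.

(** * Integral combinations and independence *)

Lemma torsion_free_mulrn_inj (W : zmodType) (n : nat) :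
  torsion_free W -> (0 < n)%N -> injective (fun x : W => x *+ n).
Proof.
move=> tfW n_gt0 x y /eqP; rewrite -subr_eq0 -mulrnBl => /eqP /(tfW _ _ n_gt0).
by move/eqP; rewrite subr_eq0 => /eqP.
Qed.

Lemma additive_exists (U V : zmodType) (f : U -> V) :
  zmod_morphism f -> exists g : {additive U -> V}, g =1 f.
Proof.
move=> fB; pose F := GRing.isZmodMorphism.Build U V f fB.
pose g : {additive U -> V} := HB.pack f F.
by exists g.
Qed.

Section Combinations.
Variables (G W : zmodType).
Implicit Types (s : seq (int * G)) (t : G -> W).

Definition combination t s : W := \sum_(p <- s) t p.2 *~ p.1.

Lemma combination_cat t s1 s2 :
  combination t (s1 ++ s2) = combination t s1 + combination t s2.
Proof. by rewrite /combination big_cat. Qed.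

Lemma combination_scale t (m : int) s :
  combination t [seq (p.1 * m, p.2) | p <- s] = combination t s *~ m.
Proof.
rewrite /combination big_map mulrz_suml; apply: eq_bigr => p _ /=.
by rewrite mulrzA.
Qed.

(** Grouping the terms that have the same vector brings a combination into
    the form to which the definition of independence applies. *)
Lemma combination_regroup t s :
  combination t s =
  \sum_(x <- undup (unzip2 s)) t x *~ (\sum_(p <- s | p.2 == x) p.1).
Proof.
under eq_bigr => x _ do rewrite mulrz_sumr.
rewrite (exchange_big_dep predT) //= /combination.
rewrite !big_seq; apply: eq_bigr => p ps /=.
rewrite -big_filter (_ : [seq x <- _ | _] = [:: p.2]) ?big_seq1 //.
rewrite (eq_filter (a2 := pred1 p.2)) => [|x]; last by rewrite /= eq_sym.
by rewrite filter_pred1_uniq ?undup_uniq // mem_undup map_f.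
Qed.

End Combinations.

(** This is what makes a map prescribed on an independent set well defined:
    after regrouping, independence kills every coefficient, so the same
    relation holds for arbitrary values [t] of the vectors. *)
Lemma independent_combination (G W : zmodType) (t : G -> W) (X : set G)
    (s : seq (int * G)) :
  independent X -> {in s, forall p, p.2 \in X} ->
  combination id s = 0 -> combination t s = 0.
Proof.
move=> indX sX; rewrite !combination_regroup => s0.
rewrite big_seq big1 // => x xs.
have -> : \sum_(p <- s | p.2 == x) p.1 = 0; last by rewrite mulr0z.
apply: (indX _ _ (undup_uniq _) _ s0 x xs) => y.
by rewrite mem_undup => /mapP[p ps ->]; exact: sX.
Qed.

(** * Rational bases *)

(** The span is taken over the rationals, expressed by clearing denominators. *)
Definition rationally_spanning (G : zmodType) (X : set G) : Prop :=
  forall g : G, exists (n : nat) (s : seq (int * G)),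
    [/\ (0 < n)%N, {in s, forall p, p.2 \in X} & g *+ n = combination id s].

(** If [g] lies outside [X], maximality yields an integral relation on
    [X] and [g]; the coefficient of [g] is nonzero because [X] is independent,
    and solving the relation for [g] expresses a multiple of [g]. *)
Lemma maximal_independent_spanning (G : zmodType) (X : set G) :
  maximal_independent X -> rationally_spanning X.
Proof.
move=> [indX maxX] g.
have [gX|gX] := pselect (X g).
  exists 1%N, [:: (1, g)]; split=> //.
    by move=> p; rewrite mem_seq1 => /eqP -> /=; rewrite inE.
  by rewrite /combination big_seq1.
have : ~ independent (X `|` [set g]).
  by move=> ind; apply/gX/(maxX _ ind); [left | right].
move=> /existsNP[s /existsNP[c /not_implyP[us /not_implyP[sX]]]].
move=> /not_implyP[s0 cN0].
have gs : g \in s.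
  apply: contrapT => gs; apply/cN0/indX => // x xs.
  by have := sX _ xs; rewrite !inE => -[//|xg]; rewrite -xg xs in gs.
have s'X : {subset rem g s <= X}.
  move=> x; rewrite (mem_rem_uniq _ us) inE => /andP[xg xs].
  by have := sX _ xs; rewrite !inE => -[//|/eqP]; rewrite (negPf xg).
rewrite (perm_big _ (perm_to_rem gs)) big_cons /= in s0.
have cg : c g != 0.
  apply/eqP => cg; apply: cN0 => x xs.
  have [-> //|xg] := eqVneq x g.
  apply: (indX (rem g s)) => //; first exact: rem_uniq.
    by move: s0; rewrite cg mulr0z add0r.
  by rewrite (mem_rem_uniq _ us) inE xg.
(* The sign turns the coefficient of [g] into the natural number [|c g|]. *)
exists `|c g|%N,
  [seq (p.1 * - sgz (c g), p.2) | p <- [seq (c x, x) | x <- rem g s]].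
split; first by rewrite absz_gt0.
  by move=> p /mapP[q /mapP[x xs ->] ->] /=; exact: s'X.
rewrite combination_scale /combination big_map /=.
move/eqP: s0; rewrite addrC addr_eq0 => /eqP ->.
rewrite mulrNz mulNrz opprK -mulrzA [LHS]pmulrn; congr (_ *~ _).
by rewrite mulrC -abszEsg.
Qed.

Record rational_basis (G : zmodType) (X : set G) : Prop := RationalBasis {
  basis_independent : independent X;
  basis_spanning : rationally_spanning X }.

Lemma additive_eq_on_spanning (G W : zmodType) (X : set G)
    (f g : {additive G -> W}) :
  torsion_free W -> rationally_spanning X -> {in X, f =1 g} -> f =1 g.
Proof.
move=> tfW spX fg x; have [n [s [n_gt0 sX xE]]] := spX x.
apply: (torsion_free_mulrn_inj tfW n_gt0) => /=.
rewrite -!raddfMn /= xE !raddf_sum; apply: eq_big_seq => p /sX pX.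
by rewrite !raddfMz fg.
Qed.

(** The relation [R g w] says that some relation expressing a multiple of [g]
    in the basis holds for [w] and the prescribed values. It is total because
    [X] spans and [W] is divisible, compatible with subtraction, and functional
    because [X] is independent and [W] is torsion-free. *)
Lemma basis_extension (G W : zmodType) (X : set G) (t : G -> W) :
  torsion_free W -> divisible W -> rational_basis X ->
  exists f : {additive G -> W}, {in X, f =1 t}.
Proof.
move=> tfW divW [indX spX].
pose R (g : G) (w : W) := exists (n : nat) (s : seq (int * G)),
  [/\ (0 < n)%N, {in s, forall p, p.2 \in X},
      g *+ n = combination id s & w *+ n = combination t s].
have R_total g : exists w, R g w.
  have [n [s [n_gt0 sX gE]]] := spX g.
  have [w wE] := divW n (combination t s) n_gt0.
  by exists w, n, s.
have R_sub g1 w1 g2 w2 : R g1 w1 -> R g2 w2 -> R (g1 - g2) (w1 - w2).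
  move=> [n1 [s1 [n1_gt0 s1X g1E w1E]]] [n2 [s2 [n2_gt0 s2X g2E w2E]]].
  exists (n1 * n2)%N, ([seq (p.1 * n2%:Z, p.2) | p <- s1] ++
                   [seq (p.1 * - n1%:Z, p.2) | p <- s2]).
  rewrite muln_gt0 n1_gt0 n2_gt0 !combination_cat !combination_scale.
  rewrite -g1E -g2E -w1E -w2E; split=> //.
  - move=> p; rewrite mem_cat => /orP[] /mapP[q qs ->].
      exact: s1X qs.
    exact: s2X qs.
  - by rewrite mulrnBl mulrNz -!pmulrn -!mulrnA (mulnC n2).
  - by rewrite mulrnBl mulrNz -!pmulrn -!mulrnA (mulnC n2).
have R0 w : R 0 w -> w = 0.
  move=> [n [s [n_gt0 sX s0 wE]]]; apply: (tfW n) => //.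
  by rewrite wE (independent_combination t indX sX) // -s0 mul0rn.
have R_fun g w1 w2 : R g w1 -> R g w2 -> w1 = w2.
  move=> Rw1 /(R_sub _ _ _ _ Rw1); rewrite subrr => /R0/eqP.
  by rewrite subr_eq0 => /eqP.
have [f0 f0P] := choice R_total.
have [f fE] : exists f : {additive G -> W}, f =1 f0.
  by apply: additive_exists => x y; apply: R_fun (R_sub _ _ _ _ _ _).
exists f => x xX; rewrite fE; apply: R_fun (f0P x) _.
exists 1%N, [:: (1, x)]; split=> //.
- by move=> p; rewrite mem_seq1 => /eqP ->.
- by rewrite /combination big_seq1.
- by rewrite /combination big_seq1.
Qed.

Lemma chain_covers_seq (T : choiceType) (F : set (set T)) (s : seq T) :
  total_on F subset -> s != [::] -> {in s, forall x, (\bigcup_(X in F) X) x} ->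
  exists2 X, F X & {in s, forall x, X x}.
Proof.
move=> chF; elim: s => // x s IHs _ sF.
have [Y FY Yx] := sF x (mem_head _ _).
have [->|s_neq0] := eqVneq s [::].
  by exists Y => // y; rewrite mem_seq1 => /eqP ->.
have [y ys|Z FZ sZ] := IHs s_neq0; first by apply: sF; rewrite in_cons ys orbT.
have [YZ|ZY] := chF _ _ FY FZ.
  by exists Z => // y; rewrite in_cons => /predU1P[->|/sZ //]; exact: YZ.
by exists Y => // y; rewrite in_cons => /predU1P[-> //|/sZ]; exact: ZY.
Qed.

(** Zorn's lemma applies because independence only involves finitely many
    elements at a time. *)
Lemma exists_maximal_independent (G : zmodType) :
  exists X : set G, maximal_independent X.
Proof.
have [F Find chF|X [indX maxX]] := @Zorn_bigcup G (@independent G).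
  move=> s c us sF s0.
  have [->//|s_neq0] := eqVneq s [::].
  have [|X FX sX] := chain_covers_seq chF s_neq0.
    by move=> x /sF; rewrite inE.
  by apply: (Find _ FX) => // x /sX Xx; rewrite inE.
exists X; split=> // Y indY XY; apply: contrapT => YX.
by apply: (maxX Y) => //; split.
Qed.

(** * Rational vector spaces of finite dimension *)

Lemma rat_basis1 : rational_basis [set 1 : rat].
Proof.
split=> [s c us s1 s0 x xs|q].
  have x1 : x = 1 by have := s1 x xs; rewrite inE.
  have sE : s = [:: 1].
    apply: perm_small_eq => //; apply: uniq_perm => // y; rewrite mem_seq1.
    apply/idP/eqP => [/s1|->]; last by rewrite -x1.
    by rewrite inE.
  move: s0; rewrite sE big_seq1 x1 => /eqP.
  by rewrite intr_eq0 => /eqP.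
exists `|denq q|%N, [:: (numq q, 1)]; split.
- by rewrite absz_gt0 denq_neq0.
- by move=> p; rewrite mem_seq1 => /eqP ->; rewrite inE.
rewrite /combination big_seq1 /= numqE -[LHS]mulr_natr.
by rewrite pmulrn absz_denq.
Qed.

Definition coHopfian (G : zmodType) : Prop :=
  forall f : {additive G -> G}, injective f -> forall y, exists x, f x = y.

(** Additive maps between rational vector spaces are linear, so this is the
    fact that an injective endomorphism in finite dimension is bijective. *)
Lemma rational_space_coHopfian (V : vectType rat) : coHopfian V.
Proof.
move=> f f_inj y.
have fZ : scalable f by apply: rat_linear; exact: raddfB.
have f_lin : linear f by move=> a u v; rewrite raddfD fZ.
pose F := GRing.isLinear.Build rat V V *:%R f f_lin.
pose g : {linear V -> V} := HB.pack (f : V -> V) F.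
have kg : lker (linfun g) == 0%VS.
  by apply/lker0P => u v; rewrite !lfunE => /f_inj.
exists ((linfun g)^-1%VF y).
by have := lker0_lfunVK kg y; rewrite lfunE.
Qed.

Lemma isomorphic_coHopfian (G H : zmodType) :
  isomorphic_groups G H -> coHopfian H -> coHopfian G.
Proof.
move=> [phi [psi phiK psiK]] coH f f_inj y.
have psiB : zmod_morphism psi by exact: can2_zmod_morphism phiK psiK.
have [g gE] : exists g : {additive H -> H}, g =1 phi \o f \o psi.
  by apply: additive_exists => u v /=; rewrite psiB !raddfB.
have [|x] := coH g _ (phi y).
  by move=> u v; rewrite !gE /= => /(can_inj phiK)/f_inj/(can_inj psiK).
by rewrite gE /= => /(can_inj phiK) fx; exists (psi x).
Qed.

(** The value of [m] at [q] is the multiple of [x] by the rational [q]. *)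
Lemma rational_line (G : zmodType) (x : G) :
  torsion_free G -> divisible G -> exists m : {additive rat -> G}, m 1 = x.
Proof.
move=> tfG divG.
have [m mE] := basis_extension (fun=> x) tfG divG rat_basis1.
by exists m; rewrite mE // inE.
Qed.

Lemma rational_power_torsion_free n : torsion_free {ffun 'I_n -> rat}.
Proof.
move=> k v k_gt0 /ffunP v0; apply/ffunP => i; apply/eqP.
have /eqP := v0 i; rewrite ffunMnE !ffunE mulrn_eq0.
by rewrite eqn0Ngt k_gt0.
Qed.

Lemma rational_power_divisible n : divisible {ffun 'I_n -> rat}.
Proof.
move=> k v k_gt0; exists [ffun i => v i / k%:R].
apply/ffunP => i; rewrite ffunMnE ffunE -[LHS]mulr_natr divfK //.
by rewrite pnatr_eq0 -lt0n.
Qed.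

(** The coordinate map [f] extends the assignment of unit vectors to basis
    elements; its inverse [h] forms the linear combination with given rational
    coefficients. That [h \o f] is the identity is only checked on the basis. *)
Lemma enumerated_basis_isomorphic (G : zmodType) (n : nat) (b : 'I_n -> G) :
  torsion_free G -> divisible G -> injective b ->
  rational_basis [set b i | i in [set: 'I_n]] ->
  isomorphic_groups G {ffun 'I_n -> rat}.
Proof.
move=> tfG divG b_inj basisX.
pose W : zmodType := {ffun 'I_n -> rat}.
pose delta i : W := [ffun j => (i == j)%:R].
have [f fE] := basis_extension (fun x => [ffun j => (x == b j)%:R] : W)
  (@rational_power_torsion_free n) (@rational_power_divisible n) basisX.
have fb i : f (b i) = delta i.
  rewrite fE; last by rewrite inE; exists i.
  by apply/ffunP => j; rewrite !ffunE (inj_eq b_inj).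
have [m mE] := choice (fun i => rational_line (b i) tfG divG).
have [h hE] : exists h : {additive W -> G}, h =1 fun v => \sum_i m i (v i).
  apply: additive_exists => u v; rewrite -sumrB.
  by apply: eq_bigr => i _; rewrite !ffunE raddfB.
have fm i q : f (m i q) = q *: (delta i : {ffun 'I_n -> rat^o}).
  (* In the regular module, [q] is [q *: 1], and scalars come out. *)
  have fmZ : scalable (f \o m i : rat^o -> {ffun 'I_n -> rat^o}).
    by apply: rat_linear => u v /=; rewrite !raddfB.
  by have /= := fmZ q 1; rewrite /GRing.scale /= mulr1 mE fb.
exists f, h.
- move=> g; apply: (additive_eq_on_spanning (f := h \o f) (g := idfun)
    tfG (basis_spanning basisX)) => x.
  rewrite inE => -[i _ <-] /=; rewrite fb hE (bigD1 i) //= big1 => [|j ji].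
    by rewrite addr0 ffunE eqxx mE.
  by rewrite ffunE eq_sym (negPf ji) raddf0.
- move=> v; rewrite hE raddf_sum; apply/ffunP => j.
  rewrite sum_ffunE (bigD1 j) //= big1 => [|i ij].
    by rewrite fm !ffunE eqxx addr0; exact: mulr1.
  by rewrite fm !ffunE (negPf ij); exact: mulr0.
Qed.

Lemma finite_rank_isomorphic (G : zmodType) (n : nat) :
  torsion_free G -> divisible G -> has_rank G n ->
  isomorphic_groups G {ffun 'I_n -> rat}.
Proof.
move=> tfG divG [X [maxX /card_set_bijP[e [eX e_inj e_surj]]]].
have b_ex (i : 'I_n) : exists x, X x /\ e x = i.
  by have [x Xx xi] := e_surj i (ltn_ord i); exists x.
have [b bP] := choice b_ex.
apply: (@enumerated_basis_isomorphic _ _ b) => //.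
  by move=> i j bij; apply: val_inj; rewrite /= -(bP i).2 -(bP j).2 bij.
rewrite (_ : [set b i | i in _] = X); last first.
  apply/seteqP; split=> [_ [i _ <-]|x Xx]; first exact: (bP i).1.
  exists (Ordinal (eX _ Xx)) => //.
  by apply: e_inj; rewrite ?inE ?(bP _).2 //; exact: (bP _).1.
by split; [exact: maxX.1 | exact: maximal_independent_spanning].
Qed.

(** * Subgroups and direct sums *)

Section Subgroups.
Variable G : zmodType.
Implicit Types (A B C D S T : set G).

Lemma subgroupP A :
  subgroup A <-> A 0 /\ forall x y, A x -> A y -> A (x - y).
Proof.
split=> [[A0 AB]|[A0 AB]]; split.
- by move: A0; rewrite inE.
- by move=> x y Ax Ay; have := AB x y; rewrite !inE; exact.
- by rewrite inE.
- by move=> x y; rewrite !inE; exact: AB.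
Qed.

Lemma subgroup0 A : subgroup A -> A 0.
Proof. by case/subgroupP. Qed.

Lemma subgroupB A x y : subgroup A -> A x -> A y -> A (x - y).
Proof. by case/subgroupP=> _; exact. Qed.

Lemma subgroupN A x : subgroup A -> A x -> A (- x).
Proof.
by move=> sA Ax; rewrite -sub0r; apply: subgroupB => //; exact: subgroup0.
Qed.

Lemma subgroupD A x y : subgroup A -> A x -> A y -> A (x + y).
Proof.
by move=> sA Ax Ay; rewrite -[y]opprK; apply: subgroupB => //; exact: subgroupN.
Qed.

Lemma subgroupMn A x n : subgroup A -> A x -> A (x *+ n).
Proof.
move=> sA Ax; elim: n => [|n IHn]; first by rewrite mulr0n; exact: subgroup0.
by rewrite mulrS; exact: subgroupD.
Qed.

Lemma subgroup_disjointP A B : subgroup A -> subgroup B ->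
  A `&` B = [set 0] <-> forall x, A x -> B x -> x = 0.
Proof.
move=> sA sB; split=> [AB0 x Ax Bx|AB0].
  by have : (A `&` B) x by []; rewrite AB0.
apply/seteqP; split=> x; first by case; exact: AB0.
by move=> ->; split; exact: subgroup0.
Qed.

Lemma sumset_subgroup A B : subgroup A -> subgroup B ->
  subgroup [set a + b | a in A & b in B].
Proof.
move=> sA sB; apply/subgroupP; split.
  exists 0; first exact: subgroup0.
  by exists 0; [exact: subgroup0 | rewrite addr0].
move=> _ _ [a Aa [b Bb <-]] [c Ac [d Bd <-]].
exists (a - c); first exact: subgroupB.
by exists (b - d); [exact: subgroupB | rewrite opprD addrACA].
Qed.

(** If [u] is outside [S] and [v] outside [T], then [u + v] is in neither. *)
Lemma subgroup_union_full S T : subgroup S -> subgroup T ->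
  (forall g, S g \/ T g) -> S = setT \/ T = setT.
Proof.
move=> sS sT ST; apply: contrapT => /not_orP[nS nT].
have [u Su] : exists u, ~ S u.
  by apply/existsNP => Sall; apply/nS/seteqP; split.
have [v Tv] : exists v, ~ T v.
  by apply/existsNP => Tall; apply/nT/seteqP; split.
have Tu : T u by case: (ST u).
have Sv : S v by case: (ST v).
have [Suv|Tuv] := ST (u + v).
  by apply: Su; rewrite -(addrK v u); exact: subgroupB.
by apply: Tv; rewrite -(addKr u v) addrC; exact: subgroupB.
Qed.

Lemma direct_sum_projection A C : is_direct_sum A C ->
  exists p : {additive G -> G},
    [/\ forall g, A (p g), forall g, C (g - p g) & forall a, A a -> p a = a].
Proof.
move=> [sA sC AC_full /(subgroup_disjointP sA sC) AC0].
have decomp g : exists a, A a /\ C (g - a).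
  have [a Aa [c Cc <-]] : [set a + c | a in A & c in C] g by rewrite AC_full.
  by exists a; rewrite [a + c]addrC addrK.
have uniq_comp g a b : A a -> C (g - a) -> A b -> C (g - b) -> a = b.
  move=> Aa Ca Ab Cb; apply/eqP; rewrite -subr_eq0; apply/eqP/AC0.
    exact: subgroupB.
  rewrite (_ : a - b = (g - b) - (g - a)); first exact: subgroupB.
  by rewrite opprB [RHS]addrC addrA subrK.
have [p0 p0P] := choice decomp.
have [p pE] : exists p : {additive G -> G}, p =1 p0.
  apply: additive_exists => x y; have [[Ax Cx] [Ay Cy]] := (p0P x, p0P y).
  apply: (uniq_comp (x - y)); [exact: (p0P _).1|exact: (p0P _).2| |].
    exact: subgroupB.
  by rewrite opprD addrACA -opprD; exact: subgroupB.
exists p; split=> [g|g|a Aa]; rewrite pE; [exact: (p0P g).1|exact: (p0P g).2|].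
apply: (uniq_comp a); [exact: (p0P _).1|exact: (p0P _).2|by []|].
by rewrite subrr; exact: subgroup0.
Qed.

(** Project onto [A] a quotient of [a] taken in [G]. *)
Lemma summand_divisible A C (n : nat) (a : G) :
  divisible G -> is_direct_sum A C -> (0 < n)%N -> A a ->
  exists2 b, A b & b *+ n = a.
Proof.
move=> divG /direct_sum_projection[p [Ap _ pA]] n_gt0 Aa.
have [y ya] := divG n a n_gt0.
by exists (p y) => //; rewrite -raddfMn /= ya pA.
Qed.

Lemma isomorphic_subgroups_sym A B : subgroup A ->
  isomorphic_subgroups A B -> isomorphic_subgroups B A.
Proof.
move=> sA [f [[fAB f_inj f_surj] fD]].
have g_ex y : exists x, B y -> A x /\ f x = y.
  have [By|nBy] := pselect (B y); last by exists 0.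
  by have [x Ax xy] := f_surj y By; exists x.
have [g gP] := choice g_ex.
exists g; split; first split.
- by move=> y /gP[].
- by move=> x y /[!inE] /gP[_ gx] /gP[_ gy] gxy; rewrite -gx -gy gxy.
- move=> x Ax; have Bfx := fAB x Ax; exists (f x) => //.
  by apply: f_inj; rewrite ?inE //; have [] := gP _ Bfx.
- move=> x y /[!inE] Bx By; have [[Agx gx] [Agy gy]] := (gP _ Bx, gP _ By).
  have gxyE : f (g x + g y) = x + y by rewrite fD ?inE // gx gy.
  have Bxy : B (x + y) by rewrite -gxyE; apply: fAB; exact: subgroupD.
  have [Agxy gxy] := gP _ Bxy.
  by apply: f_inj; rewrite ?inE ?gxyE //; exact: subgroupD.
Qed.

(** The endomorphism [phi] that sends [a + c] to [f a + c] is injective because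
    [B] and [C] meet trivially; its surjectivity says that [B + C] is [G]. *)
Lemma coHopfian_replace_summand A B C :
  coHopfian G -> isomorphic_subgroups A B -> is_direct_sum A C ->
  subgroup B -> B `&` C = [set 0] -> is_direct_sum B C.
Proof.
move=> coG [f [[fAB f_inj _] fD]] AC sB BC0; have [sA sC _ _] := AC.
have [p [Ap Cp pA]] := direct_sum_projection AC.
have BC_disj := (subgroup_disjointP sB sC).1 BC0.
have f0 : f 0 = 0.
  apply: (addIr (f 0)); rewrite -fD ?inE ?add0r //; exact: subgroup0.
have fB x y : A x -> A y -> f (x - y) = f x - f y.
  move=> Ax Ay; apply: (addIr (f y)); rewrite -fD ?inE ?subrK //.
  exact: subgroupB.
have [phi phiE] : exists phi : {additive G -> G},
    phi =1 fun g => f (p g) + (g - p g).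
  apply: additive_exists => x y.
  rewrite raddfB fB // [in RHS]opprD [RHS]addrACA.
  by congr (_ + _); rewrite opprD addrACA -opprD.
have phi_inj : injective phi.
  apply: raddf_inj => x; rewrite phiE => /eqP; rewrite addr_eq0 => /eqP fpx.
  have fpx0 : f (p x) = 0.
    apply: BC_disj; first exact: fAB.
    by rewrite fpx; exact: subgroupN.
  have px0 : p x = 0.
    by apply: f_inj; rewrite ?inE ?f0 //; exact: subgroup0.
  by move/eqP: fpx; rewrite fpx0 px0 subr0 eq_sym oppr_eq0 => /eqP.
split=> //; apply/seteqP; split=> // y _.
have [x <-] := coG phi phi_inj y; rewrite phiE.
by exists (f (p x)); [exact: fAB | exists (x - p x)].
Qed.

(** Zorn's lemma is applied to sets closed under subtraction, which include
    the empty set, because the union of the empty chain has to qualify; a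
    maximal such set is nonempty. *)
Lemma exists_maximal_disjoint_subgroup A B : subgroup A -> subgroup B ->
  exists C, [/\ subgroup C, A `&` C = [set 0], B `&` C = [set 0] &
    forall D, subgroup D -> C `<=` D -> A `&` D = [set 0] ->
      B `&` D = [set 0] -> D `<=` C].
Proof.
move=> sA sB.
pose P C := [/\ forall x y, C x -> C y -> C (x - y),
  A `&` C `<=` [set 0] & B `&` C `<=` [set 0]].
have [F FP chF|C [[CB AC BC] maxC]] := @Zorn_bigcup G P.
  split=> [x y [X FX Xx] [Y FY Yy]|x [Ax [X FX Xx]]|x [Bx [X FX Xx]]].
  - have [XY|YX] := chF _ _ FX FY.
      by exists Y => //; have [YB _ _] := FP _ FY; apply: YB => //; exact: XY.
    by exists X => //; have [XB _ _] := FP _ FX; apply: XB => //; exact: YX.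
  - by have [_ AX _] := FP _ FX; exact: AX.
  - by have [_ _ BX] := FP _ FX; exact: BX.
have C0 : C 0.
  apply: contrapT => nC0; have C_empty x : ~ C x.
    by move=> Cx; apply: nC0; rewrite -(subrr x); exact: CB.
  apply: (maxC [set 0]).
    by split=> [x /C_empty //|/(_ 0 erefl)].
  split=> [x y -> ->|x []//|x []//].
  by rewrite /= subrr.
have sC : subgroup C by apply/subgroupP.
exists C; split=> //.
- by apply/subgroup_disjointP => // x Ax Cx; exact: AC.
- by apply/subgroup_disjointP => // x Bx Cx; exact: BC.
- move=> D sD CD AD BD; apply: contrapT => DC; apply: (maxC D) => //.
  by split=> [x y|x|x]; [exact: subgroupB | rewrite AD | rewrite BD].
Qed.

End Subgroups.

(** * Perspectivity of co-Hopfian groups *)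

(** A subgroup [C] maximal among those meeting both [A] and [B] trivially is
    already a complement of [A] or of [B]; co-Hopficity makes it a complement
    of the other. *)
Lemma coHopfian_perspective (G : zmodType) :
  torsion_free G -> divisible G -> coHopfian G -> perspective G.
Proof.
move=> tfG divG coG A H B K AH BK AB.
have [[sA _ _ _] [sB _ _ _]] := (AH, BK).
have [C [sC AC BC maxC]] := exists_maximal_disjoint_subgroup sA sB.
have AC0 := (subgroup_disjointP sA sC).1 AC.
have BC0 := (subgroup_disjointP sB sC).1 BC.
have C_pure n x : (0 < n)%N -> C (x *+ n) -> C x.
  move=> n_gt0 Cnx.
  (* The pure closure of [C] still meets [A] and [B] trivially. *)
  pose D := [set y | exists2 k, (0 < k)%N & C (y *+ k)].
  have sD : subgroup D.
    apply/subgroupP; split; first by exists 1%N => //; exact: subgroup0.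
    move=> y z [k k_gt0 Ck] [l l_gt0 Cl]; exists (k * l)%N.
      by rewrite muln_gt0 k_gt0.
    rewrite mulrnBl; apply: subgroupB => //.
      by rewrite mulrnA; exact: subgroupMn.
    by rewrite mulnC mulrnA; exact: subgroupMn.
  have D_disj E : subgroup E -> (forall y, E y -> C y -> y = 0) ->
      E `&` D = [set 0].
    move=> sE EC0; apply/subgroup_disjointP => // y Ey [k k_gt0 Cky].
    by apply: (tfG k) => //; apply: EC0 => //; exact: subgroupMn.
  apply: (maxC D sD _ (D_disj A sA AC0) (D_disj B sB BC0)); last by exists n.
  by move=> y Cy; exists 1%N.
(* If the subgroup generated by [C] and [g] meets a summand [E] outside zero,
   dividing in [E] and then in the pure [C] puts [g] in [E + C]. *)
have meet_sum E L g c n : is_direct_sum E L ->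
    (forall y, E y -> C y -> y = 0) -> C c -> E (c + g *+ n) ->
    c + g *+ n = 0 \/ [set a + c | a in E & c in C] g.
  move=> EL EC0 Cc Ex; case: (posnP n) => [n0|n_gt0].
    by left; apply: EC0; rewrite // n0 mulr0n addr0.
  right; have [a Ea aE] := summand_divisible divG EL n_gt0 Ex.
  exists a => //; exists (g - a); last by rewrite addrCA subrr addr0.
  apply: (C_pure n) => //; rewrite mulrnBl aE opprD addrCA subrr addr0.
  exact: subgroupN.
have [] : [set a + c | a in A & c in C] = setT \/
          [set b + c | b in B & c in C] = setT.
- apply: subgroup_union_full => [||g]; [exact: sumset_subgroup..|].
  apply: contrapT => /not_orP[gA gB].
  (* Were [g] in neither sum, the subgroup generated by [C] and [g] would
     contradict the maximality of [C]. *)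
  pose D := [set c + g *~ k | c in C & k in [set: int]].
  have sD : subgroup D.
    apply/subgroupP; split.
      by exists 0; [exact: subgroup0 | exists 0; rewrite ?addr0 ?mulr0z].
    move=> _ _ [c Cc [k _ <-]] [d Cd [l _ <-]].
    exists (c - d); first exact: subgroupB.
    by exists (k - l) => //; rewrite mulrzBr opprD addrACA.
  have D_disj E L : is_direct_sum E L -> (forall y, E y -> C y -> y = 0) ->
      ~ [set a + c | a in E & c in C] g -> E `&` D = [set 0].
    move=> EL EC0 gE; have [sE _ _ _] := EL.
    apply/subgroup_disjointP => // x Ex [c Cc [[n|n] _ xE]];
      rewrite -{x}xE in Ex *.
      by have [] := meet_sum _ _ g c n EL EC0 Cc Ex.
    have xE : - c + g *+ n.+1 = - (c + g *~ Negz n).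
      by rewrite NegzE mulrNz opprB addrC.
    have /= := subgroupN sE Ex; rewrite -xE => Enx.
    have [/eqP|//] := meet_sum _ _ _ _ _ EL EC0 (subgroupN sC Cc) Enx.
    by rewrite xE oppr_eq0 => /eqP.
  have Dg : D g by exists 0; [exact: subgroup0 | exists 1; rewrite ?add0r].
  have CD : C `<=` D.
    by move=> c Cc; exists c => //; exists 0; rewrite ?mulr0z ?addr0.
  have Cg := maxC D sD CD (D_disj _ _ AH AC0 gA) (D_disj _ _ BK BC0 gB) g Dg.
  by apply: gA; exists 0; [exact: subgroup0 | exists g; rewrite ?add0r].
- move=> AC_full; have dAC : is_direct_sum A C by split.
  by exists C; split=> //; exact: coHopfian_replace_summand AB dAC sB BC.
- move=> BC_full; have dBC : is_direct_sum B C by split.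
  have BA := isomorphic_subgroups_sym sA AB.
  by exists C; split=> //; exact: coHopfian_replace_summand BA dBC sA AC.
Qed.

(** * Perspective groups have finite rank *)

(** The summands compared are [G], whose only complement is trivial, and its
    isomorphic copy [range f], which is complemented by the kernel of [g]. *)
Lemma perspective_left_inverse_injective (G : zmodType)
    (f g : {additive G -> G}) :
  perspective G -> cancel f g -> injective g.
Proof.
move=> perspG fK.
have sT : subgroup [set: G] by apply/subgroupP.
have s0 : subgroup [set 0 : G].
  by apply/subgroupP; split=> // x y -> ->; rewrite subrr.
have sR : subgroup (range f).
  apply/subgroupP; split; first by exists 0; rewrite ?raddf0.
  by move=> _ _ [x _ <-] [y _ <-]; exists (x - y); rewrite ?raddfB.
have sK : subgroup [set x | g x = 0].
  apply/subgroupP; split=> [|x y /= gx gy]; first exact: raddf0.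
  by rewrite /= raddfB gx gy subrr.
have dT : is_direct_sum [set: G] [set 0].
  split=> //; last by rewrite setTI.
  by apply/seteqP; split=> // x _; exists x => //; exists 0; rewrite ?addr0.
have dR : is_direct_sum (range f) [set x | g x = 0].
  split=> //.
    apply/seteqP; split=> // x _; exists (f (g x)); first by exists (g x).
    exists (x - f (g x)); first by rewrite /= raddfB fK subrr.
    by rewrite addrCA subrr addr0.
  apply/subgroup_disjointP => // _ [x _ <-] /=; rewrite fK => ->.
  by rewrite raddf0.
have TR : isomorphic_subgroups [set: G] (range f).
  exists f; split; last by move=> x y _ _; rewrite raddfD.
  by split=> [x _|x y _ _ /(can_inj fK)|] //; exists x.
have [C [[_ _ _ TC] [_ _ RC _]]] := perspG _ _ _ _ dT dR TR.
apply: raddf_inj => x gx.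
have [_ [y _ <-] [c Cc xE]] : [set a + c | a in range f & c in C] x.
  by rewrite RC.
have c0 : c = 0 by rewrite setTI in TC; rewrite TC in Cc.
by move: gx; rewrite -xE c0 addr0 fK => ->; rewrite raddf0.
Qed.

Lemma function_on_sequence (T : Type) (e u : nat -> T) : injective e ->
  exists s : T -> T,
    (forall n, s (e n) = u n) /\ (forall x, ~ range e x -> s x = x).
Proof.
move=> e_inj.
have s_ex x : exists y,
    (forall n, x = e n -> y = u n) /\ (~ range e x -> y = x).
  have [[n _ <-]|nx] := pselect (range e x); last first.
    by exists x; split=> // n xE; case: nx; exists n.
  by exists (u n); split=> [k /e_inj -> //|[]]; exists n.
have [s sP] := choice s_ex.
by exists s; split=> [n|x /(sP x).2 //]; exact: (sP _).1.
Qed.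

Lemma infinite_set_sequence (T : Type) (X : set T) :
  infinite_set X -> exists e : nat -> T, injective e /\ forall n, X (e n).
Proof.
move=> /infiniteP/card_leP[e].
exists (fun n => set_val (e (SigSub (mem_setT n)))); split=> [m n|n].
  move/val_inj => /inj => /(_ (mem_setT _) (mem_setT _)) emn.
  by case: emn.
exact: set_valP.
Qed.

(** In an infinite basis, [f] shifts a sequence [e] of distinct elements and
    [g] shifts it back, with [g (e 0) = 0]; both fix the other basis elements.
    Then [g] is a non-injective left inverse of [f]. *)
Lemma perspective_basis_finite (G : zmodType) (X : set G) :
  torsion_free G -> divisible G -> perspective G -> rational_basis X ->
  finite_set X.
Proof.
move=> tfG divG perspG basisX; apply: contrapT.
move=> /infinite_set_sequence[e [e_inj eX]].
have [s [se sN]] := function_on_sequence (fun n => e n.+1) e_inj.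
have [r [re rN]] :=
  function_on_sequence (fun n => if n is m.+1 then e m else 0) e_inj.
have [f fE] := basis_extension s tfG divG basisX.
have [g gE] := basis_extension r tfG divG basisX.
have fK : cancel f g.
  apply: (additive_eq_on_spanning (f := g \o f) (g := idfun)
    tfG (basis_spanning basisX)) => x xX /=; rewrite fE //.
  have [[n _ <-]|nx] := pselect (range e x); last by rewrite sN // gE // rN.
  by rewrite se gE ?re // inE.
have ge0 : g (e 0) = g 0 by rewrite raddf0 gE ?re // inE.
have e0_eq0 := perspective_left_inverse_injective perspG fK ge0.
have := basis_independent basisX (s := [:: 0]) (c := fun=> 1).
move=> /(_ isT) one0; suff : (1 : int) = 0 by [].
apply: (one0 _ _ 0); rewrite ?mem_seq1 //; last by rewrite big_seq1 mul0rz.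
by move=> y; rewrite mem_seq1 => /eqP ->; rewrite -e0_eq0 inE.
Qed.

(** * Finite rank and perspectivity *)

Theorem proposition3p12 (G : zmodType)
    (tfG : torsion_free G) (divG : divisible G) :
  (perspective G <-> finite_rank G) /\
  (finite_rank G ->
     exists n : nat, isomorphic_groups G {ffun 'I_n -> rat}).
Proof.
have iso : finite_rank G ->
    exists n : nat, isomorphic_groups G {ffun 'I_n -> rat}.
  by move=> [n rank_n]; exists n; exact: finite_rank_isomorphic.
split=> //; split=> [perspG|/iso[n Gn]].
  have [X maxX] := exists_maximal_independent G.
  have basisX : rational_basis X.
    by split; [exact: maxX.1 | exact: maximal_independent_spanning].
  have /finite_setP[n Xn] := perspective_basis_finite tfG divG perspG basisX.
  by exists n, X.
apply: coHopfian_perspective => //; apply: isomorphic_coHopfian Gn _.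
exact: (@rational_space_coHopfian {ffun 'I_n -> rat^o}).
Qed.
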